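(* Let $G$ be a (small) groupoid and let $s : G \to \mathrm{Top}^{\mathrm{op}}$ be a functor (a groupoid dynamical system) such that for each $e \in \mathrm{ob}(G)$ the group $G_e$ of all morphisms $e \to e$ is countable and the topological space $s(e)$ is Tychonoff and Baire. Put $A = \bigoplus_{e \in \mathrm{ob}(G)} C(e)$, where $C(e)$ is the ring of continuous functions $s(e) \to \mathbb{C}$, and let $A \rtimes^{\sigma} G$ be the associated skew category algebra. Then the following assertions are equivalent: (i) $s$ is topologically free; (ii) if $I$ is a nonzero (two-sided) ideal of $A \rtimes^{\sigma} G$, then $I \cap A \neq \{0\}$; (iii) the ring $A$ is a maximal abelian complex subalgebra of $A \rtimes^{\sigma} G$.
   Context: All categories are small. For a morphism $n$ of $G$, $d(n)$ and $c(n)$ denote its domain and codomain; objects are identified with their identity morphisms; $mn$ is defined when $d(m)=c(n)$. $\mathrm{Top}$ is the category of topological spaces and continuous maps. A functor $s : G \to \mathrm{Top}^{\mathrm{op}}$ thus assigns to each object $e$ a space $s(e)$ and to each morphism $n$ a continuous map $s(n) : s(c(n)) \to s(d(n))$, with $s(mn) = s(n)\circ s(m)$ (ordinary composition of maps) and $s(e)=\mathrm{id}_{s(e)}$ for identities. Topologically free: an element $x \in s(e)$ is periodic if there is a nonidentity morphism $n : e \to e$ in $G$ with $s(n)(x)=x$, and aperiodic otherwise; $s$ is topologically free if for every $e\in\mathrm{ob}(G)$ the set of aperiodic elements of $s(e)$ is dense in $s(e)$. Tychonoff means Hausdorff and completely regular (for each open $U$ and $x\in U$ there is a continuous function $f$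 on the space with $f(x)=1$ and $f=0$ off $U$). For each morphism $n$ define $\sigma(n): C(d(n)) \to C(c(n))$ by $\sigma(n)(f) = f\circ s(n)$. The skew category algebra $A \rtimes^{\sigma} G$ is the set of formal sums $\sum_{n\in G} a_n u_n$ over morphisms $n$ of $G$, with $a_n \in C(c(n))$ and $a_n = 0$ for all but finitely many $n$, with componentwise addition and multiplication $$\Big(\sum_{n} a_n u_n\Big)\Big(\sum_{n} b_n u_n\Big) = \sum_{n} \Big(\sum_{mm'=n,\ d(m)=c(m')} a_m\,\sigma(m)(b_{m'})\Big) u_n .$$ $A$ is regarded as a subring via $\sum_e a_e \mapsto \sum_{e\in \mathrm{ob}(G)} a_e u_e$. Maximal abelian means that $A$ (which is commutative) equals its commutant in $A \rtimes^{\sigma} G$. *)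

(* Defs.v *)
From HB Require Import structures.
From mathcomp Require Import all_boot all_order all_algebra.
From mathcomp Require Import all_classical topology normedtype.
Set Implicit Arguments.
Unset Strict Implicit.
Unset Printing Implicit Defensive.
Import GRing.Theory.
Import numFieldNormedType.Exports.
Local Open Scope classical_set_scope.
Local Open Scope ring_scope.

Record category := Category {
  ob :> choiceType;
  homset : ob -> ob -> choiceType;
  idmor : forall x : ob, homset x x;
  mcomp : forall x y z : ob, homset y z -> homset x y -> homset x z;
  mcompA : forall (w x y z : ob) (m : homset y z) (n : homset x y) (p : homset w x),
    mcomp m (mcomp n p) = mcomp (mcomp m n) p;
  mcomp1m : forall (x y : ob) (n : homset x y), mcomp (idmor y) n = n;
  mcompm1 : forall (x y : ob) (n : homset x y), mcomp n (idmor x) = n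
}.

Arguments idmor {c} x.
Arguments mcomp {c x y z} m n.

Definition groupoid (G : category) : Prop :=
  forall (x y : G) (n : homset x y),
    exists m : homset y x, mcomp m n = idmor x /\ mcomp n m = idmor y.

Definition mor (G : category) : Type := {x : G & {y : G & homset x y}}.

Definition Mor (G : category) (x y : G) (n : homset x y) : mor G :=
  existT (fun x : G => {y : G & homset x y}) x (existT (fun y : G => homset x y) y n).

Lemma Mor_dom (G : category) (x y x' y' : G) (n : homset x y) (n' : homset x' y') :
  Mor n = Mor n' -> x = x'.
Proof. by move/(congr1 (fun m : mor G => projT1 m)). Qed.

Lemma Mor_cod (G : category) (x y x' y' : G) (n : homset x y) (n' : homset x' y') :
  Mor n = Mor n' -> y = y'.
Proof. by move/(congr1 (fun m : mor G => projT1 (projT2 m))). Qed.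

Lemma Mor_inj (G : category) (x y : G) : injective (@Mor G x y).
Proof. by move=> m n /eqP; rewrite /Mor !eq_Tagged => /eqP. Qed.

(* [n] is the identity of some object; since [n : homset x y] with [x] and [y] a
   priori distinct, the comparison takes place among all morphisms of [G]. *)
Definition is_identity (G : category) (x y : G) (n : homset x y) : Prop :=
  exists e : G, Mor n = Mor (idmor e).

(* A functor from [G] to the opposite of the category of topological spaces. *)
Record dynsys (G : category) := DynSys {
  fiber :> G -> topologicalType;
  smap : forall x y : G, homset x y -> fiber y -> fiber x;
  smap_continuous : forall (x y : G) (n : homset x y), continuous (smap n);
  smap_id : forall x : G, smap (idmor x) = idfun;
  smap_comp : forall (x y z : G) (m : homset y z) (n : homset x y),
    smap (mcomp m n) = smap n \o smap m
}.

Arguments smap {G} d {x y} n.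
Arguments smap_continuous {G} d {x y} n.

Section top_free.
Context (G : category) (s : dynsys G).

Definition periodic (e : G) (x : s e) : Prop :=
  exists n : homset e e, n <> idmor e /\ smap s n x = x.

Definition aperiodic (e : G) : set (s e) := [set x | ~ periodic x].

Definition topologically_free : Prop := forall e : G, dense (@aperiodic e).

End top_free.

Definition baire_space (X : topologicalType) : Prop :=
  forall F : nat -> set X,
    (forall i, open (F i) /\ dense (F i)) -> dense (\bigcap_i F i).

Section cfun.
Context (K : numFieldType) (X : topologicalType).

Definition cfun : Type := continuousType X K.

HB.instance Definition _ := Choice.on cfun.

Definition cfun_pred : {pred X -> K} := mem [set f | continuous f].

Definition cfun_Sub (f : X -> K) (fP : f \in cfun_pred) : cfun :=
  Continuous.Pack (Continuous.Class (isContinuous.Build _ _ f (set_mem fP))).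

Lemma cfun_rect (P : cfun -> Type) :
  (forall f (fP : f \in cfun_pred), P (cfun_Sub fP)) -> forall u : cfun, P u.
Proof.
move=> Psub [f [[fc]]].
have -> : fc = set_mem (@mem_set _ [set f : X -> K | continuous f] f fc).
  exact: Prop_irrelevance.
exact: Psub.
Qed.

Lemma cfun_SubK (f : X -> K) (fP : f \in cfun_pred) :
  (cfun_Sub fP : X -> K) = f.
Proof. by []. Qed.

HB.instance Definition _ :=
  isSub.Build (X -> K) cfun_pred cfun cfun_rect cfun_SubK.

Lemma cfun_subring_closed : subring_closed cfun_pred.
Proof.
split=> [|f g|f g]; rewrite !inE /=.
- by move=> x; exact: cvg_cst.
- by move=> fc gc x; exact: (@continuousB _ _ _ f g x (fc x) (gc x)).
- by move=> fc gc x; exact: (@continuousM _ _ f g x (fc x) (gc x)).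
Qed.

Lemma cfun_scaler_closed : GRing.scaler_closed cfun_pred.
Proof.
move=> k f; rewrite !inE /= => fc x.
exact: (@continuousZl_tmp _ _ _ f k x (fc x)).
Qed.

HB.instance Definition _ :=
  GRing.isSubringClosed.Build _ cfun_pred cfun_subring_closed.
HB.instance Definition _ :=
  GRing.isScaleClosed.Build _ _ cfun_pred cfun_scaler_closed.
HB.instance Definition _ :=
  GRing.SubChoice_isSubComPzRing.Build _ cfun_pred cfun cfun_subring_closed.
HB.instance Definition _ := [SubZmodule_isSubLmodule of cfun by <:].

(* The separating function takes its values in [K]; for [K] the complex numbers
   this is equivalent, through [f |-> |f|], to asking for a real-valued one. *)
Definition completely_regular : Prop :=
  forall (U : set X) (x : X), open U -> U x ->
    exists f : cfun, f x = 1 /\ forall y, ~ U y -> f y = 0.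

Definition tychonoff_space : Prop := hausdorff_space X /\ completely_regular.

End cfun.

Arguments cfun_pred : clear implicits.

Lemma sigma_subproof (K : numFieldType) (G : category) (s : dynsys G) (x y : G)
    (n : homset x y) (f : cfun K (s x)) :
  (f : s x -> K) \o smap s n \in cfun_pred K (s y).
Proof.
rewrite inE /= => z; apply: continuous_comp; first exact: smap_continuous.
exact: (cts_fun (s := f)).
Qed.

Definition sigma (K : numFieldType) (G : category) (s : dynsys G) (x y : G)
    (n : homset x y) (f : cfun K (s x)) : cfun K (s y) :=
  cfun_Sub (sigma_subproof n f).

Section skew_category_algebra.
Context (K : numFieldType) (G : category) (s : dynsys G).

Definition coefs : Type := forall x y : G, homset x y -> cfun K (s y).

Definition supp (a : coefs) : set (mor G) :=
  [set n | a _ _ (projT2 (projT2 n)) <> 0].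

(* [a : skew_alg] stands for the formal sum of the [a n u_n], with [n] ranging
   over the morphisms of [G]. *)
Record skew_alg := Skew {
  coef :> forall x y : G, homset x y -> cfun K (s y);
  coef_fin : finite_set (supp coef)
}.

Lemma skewP (a b : skew_alg) :
  (forall (x y : G) (n : homset x y), a x y n = b x y n) -> a = b.
Proof.
case: a b => [a fa] [b fb] /= ab.
have {}ab : a = b.
  by apply: functional_extensionality_dep => x;
     apply: functional_extensionality_dep => y;
     apply: functional_extensionality_dep => n.
by rewrite ab in fa *; congr Skew; exact: Prop_irrelevance.
Qed.

HB.instance Definition _ := gen_eqMixin skew_alg.
HB.instance Definition _ := gen_choiceMixin skew_alg.

Lemma skew0_subproof : finite_set (supp (fun _ _ _ => 0)).
Proof. by rewrite (_ : supp _ = set0) // -subset0 => n; apply. Qed.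

Definition skew0 : skew_alg := Skew skew0_subproof.

Lemma skewN_subproof (a : skew_alg) :
  finite_set (supp (fun x y n => - a x y n)).
Proof.
apply: sub_finite_set (coef_fin a) => n /= na a0; apply: na.
by rewrite a0 oppr0.
Qed.

Definition skewN (a : skew_alg) : skew_alg := Skew (skewN_subproof a).

Lemma skewD_subproof (a b : skew_alg) :
  finite_set (supp (fun x y n => a x y n + b x y n)).
Proof.
have := coef_fin a; have := coef_fin b.
move=> fb fa; have : finite_set (supp a `|` supp b) by rewrite finite_setU.
apply: sub_finite_set => n /= nab; rewrite /supp /=.
apply: contrapT => /not_orP[/contrapT a0 /contrapT b0]; apply: nab.
by rewrite a0 b0 addr0.
Qed.

Definition skewD (a b : skew_alg) : skew_alg := Skew (skewD_subproof a b).

Lemma skewZ_subproof (k : K) (a : skew_alg) :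
  finite_set (supp (fun x y n => k *: a x y n)).
Proof.
apply: sub_finite_set (coef_fin a) => n /= na a0; apply: na.
by rewrite a0 scaler0.
Qed.

Definition skewZ (k : K) (a : skew_alg) : skew_alg := Skew (skewZ_subproof k a).

Lemma skewDA : associative skewD.
Proof. by move=> a b c; apply: skewP => x y n /=; rewrite addrA. Qed.

Lemma skewDC : commutative skewD.
Proof. by move=> a b; apply: skewP => x y n /=; rewrite addrC. Qed.

Lemma skew0D : left_id skew0 skewD.
Proof. by move=> a; apply: skewP => x y n /=; rewrite add0r. Qed.

Lemma skewND : left_inverse skew0 skewN skewD.
Proof. by move=> a; apply: skewP => x y n /=; rewrite addNr. Qed.

HB.instance Definition _ :=
  GRing.isZmodule.Build skew_alg skewDA skewDC skew0D skewND.

Lemma skewZA (k l : K) (a : skew_alg) :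
  skewZ k (skewZ l a) = skewZ (k * l) a.
Proof. by apply: skewP => x y n /=; rewrite scalerA. Qed.

Lemma skew1Z : left_id 1 skewZ.
Proof. by move=> a; apply: skewP => x y n /=; rewrite scale1r. Qed.

Lemma skewZDr : right_distributive skewZ +%R.
Proof. by move=> k a b; apply: skewP => x y n /=; rewrite scalerDr. Qed.

Lemma skewZDl (a : skew_alg) : {morph skewZ^~ a : k l / k + l}.
Proof. by move=> k l; apply: skewP => x y n /=; rewrite scalerDl. Qed.

HB.instance Definition _ :=
  GRing.Zmodule_isLmodule.Build K skew_alg skewZA skew1Z skewZDr skewZDl.

(* The factorizations [n = m m'] of [n], indexed by the object [e] through
   which they pass. *)
Definition factorizations (x y : G) (n : homset x y) :
    set {e : G & (homset e y * homset x e)%type} :=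
  [set p | mcomp (projT2 p).1 (projT2 p).2 = n].

(* Since [a] and [b] have finite support, so has the summand, and
   [\sum_(p \in _)] is the sum of its nonzero values. *)
Definition skewM_coefs (a b : skew_alg) : coefs := fun x y n =>
  \sum_(p \in factorizations n)
    a _ _ (projT2 p).1 * sigma (projT2 p).1 (b _ _ (projT2 p).2).

Lemma skewM_subproof (a b : skew_alg) : finite_set (supp (skewM_coefs a b)).
Proof.
pose D (m m' : mor G) : set (mor G) :=
  [set n | exists (x e y : G) (f : homset e y) (g : homset x e),
     [/\ m = Mor f, m' = Mor g & n = Mor (mcomp f g)]].
have finD m m' : finite_set (D m m').
  have [[n0 n0D]|D0] := pselect (exists n, D m m' n); last first.
    by rewrite (_ : D m m' = set0) // -subset0 => n nD; apply: D0; exists n.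
  apply: sub_finite_set (finite_set1 n0) => n nD.
  case: n0D nD => [x [e [y [f [g [-> -> ->]]]]]] [x' [e' [y' [f' [g' [ff gg ->]]]]]].
  have := Mor_dom ff; have := Mor_cod ff; have := Mor_dom gg.
  move=> xx yy ee; subst x' y' e'.
  by rewrite (Mor_inj ff) (Mor_inj gg).
apply: (@sub_finite_set _ _
  (\bigcup_(m in supp a) \bigcup_(m' in supp b) D m m')).
  move=> [x [y n]] /= nab; apply: contrapT => nD; apply: nab.
  rewrite /skewM_coefs fsbig1 // => -[e [f g]] /= fg.
  have [a0|a0] := pselect (a _ _ f = 0); first by rewrite a0 mul0r.
  have [b0|b0] := pselect (b _ _ g = 0).
    rewrite b0 (_ : sigma f 0 = 0) ?mulr0//; exact: val_inj.
  case: nD; exists (Mor f) => //; exists (Mor g) => //.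
  by exists x, e, y, f, g; split=> //; rewrite -fg.
apply: bigcup_finite; first exact: coef_fin.
by move=> m _; apply: bigcup_finite; first exact: coef_fin.
Qed.

Definition skewM (a b : skew_alg) : skew_alg := Skew (skewM_subproof a b).

Record dirsum := Dirsum {
  dcoef :> forall e : G, cfun K (s e);
  dcoef_fin : finite_set [set e | dcoef e <> 0]
}.

Definition embed_coefs (a : dirsum) : coefs :=
  fun x y n => if `[< is_identity n >] then a y else 0.

Lemma embed_subproof (a : dirsum) : finite_set (supp (embed_coefs a)).
Proof.
apply: sub_finite_set (finite_image (fun e : G => Mor (idmor e)) (dcoef_fin a)).
move=> [x [y n]]; rewrite /supp /embed_coefs /=.
have [[e ne] a0|nid] := pselect (is_identity n); last by rewrite asboolF.
rewrite asboolT in a0; last by exists e.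
by exists e; [rewrite /= -(Mor_cod ne)|rewrite -ne].
Qed.

(* The sum of the [a e u_e], with [e] ranging over the objects of [G], [u_e]
   being attached to the identity morphism of [e]. *)
Definition embed (a : dirsum) : skew_alg := Skew (embed_subproof a).

Definition diag : set skew_alg := range embed.

Definition two_sided_ideal (I : set skew_alg) : Prop :=
  [/\ I 0, forall a b, I a -> I b -> I (a - b),
      forall a b, I b -> I (skewM a b) & forall a b, I a -> I (skewM a b)].

Definition subalgebra (B : set skew_alg) : Prop :=
  [/\ B 0, forall (k : K) a b, B a -> B b -> B (k *: a + b)
    & forall a b, B a -> B b -> B (skewM a b)].

Definition commutant (B : set skew_alg) : set skew_alg :=
  [set a | forall b, B b -> skewM a b = skewM b a].

Definition maximal_abelian_subalgebra (B : set skew_alg) : Prop :=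
  subalgebra B /\ commutant B = B.

End skew_category_algebra.

Arguments skew_alg K {G} s.
Arguments diag K {G} s.

(* Main.v *)
Require Import Defs.
From HB Require Import structures.
From mathcomp Require Import all_boot all_order all_algebra.
From mathcomp Require Import finmap complex.
From mathcomp Require Import all_classical all_reals topology normedtype.
Set Implicit Arguments.
Unset Strict Implicit.
Unset Printing Implicit Defensive.
Import GRing.Theory.
Import numFieldNormedType.Exports.
Local Open Scope classical_set_scope.
Local Open Scope ring_scope.

(* If s is topologically free and a_n <> 0, choose an aperiodic p with
   a_n(p) <> 0; multiplying a by u_(n^-1) and cutting down with functions
   supported near p kills every coefficient except the one at the identity, and
   a commutes with A only if it is supported on identities.  If s is not
   topologically free, Baire's theorem yields n <> id in some G_e and f <> 0 in
   C(e) supported in the fixed points of s(n).  Then f u_n commutes with A, and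
   f u_e - f u_n lies in the kernel of the covariant representation
   (a phi)(z) = \sum_n a_n(z) phi(s(n) z), an ideal meeting A trivially. *)

Lemma fsbig_single (V : nmodType) (T : choiceType) (D : set T) (t : T)
    (F : T -> V) :
  D t -> (forall t', D t' -> t' <> t -> F t' = 0) -> \sum_(i \in D) F i = F t.
Proof.
move=> Dt F0; rewrite -(@fsbig_widen _ _ _ _ [set t] D) ?fsbig_set1//.
  by move=> _ ->.
by move=> t' [Dt' /= tt']; exact: F0.
Qed.

Section algebra.
Context (K : numFieldType) (G : category) (s : dynsys G).
Implicit Types (a b : skew_alg K s) (d : dirsum K s).

Lemma sigma0 (x y : G) (n : homset x y) : sigma n (0 : cfun K (s x)) = 0.
Proof. exact: val_inj. Qed.

Lemma sigma_idmor (x : G) (f : cfun K (s x)) : sigma (idmor x) f = f.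
Proof. by apply: val_inj; rewrite /= smap_id. Qed.

Lemma cfun_eq (X : topologicalType) (f g : cfun K X) : f =1 g -> f = g.
Proof. by move=> fg; apply: val_inj; apply/funext. Qed.

Lemma cfun_neq0 (X : topologicalType) (f : cfun K X) :
  f <> 0 -> exists z, f z <> 0.
Proof.
move=> f0; apply: contrapT => /forallNP fz; apply: f0; apply: cfun_eq => z.
exact: contrapT (fz z).
Qed.

Lemma open_cfun_neq0 (X : topologicalType) (f : cfun K X) :
  open [set z | f z <> 0].
Proof.
have -> : [set z | f z <> 0] = f @^-1` (~` [set 0]) by [].
apply: open_comp; first by move=> z _; exact: (cts_fun (s := f)).
apply: closed_openC; apply: accessible_closed_set1.
exact: hausdorff_accessible (@norm_hausdorff K K).
Qed.

Definition mono_coefs (x y : G) (n : homset x y) (f : cfun K (s y)) :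
    coefs K s := fun x' y' m =>
  @eqtype.dfwith _ (fun m : mor G => cfun K (s (projT1 (projT2 m)))) (fun=> 0)
    (Mor n) f (Mor m).

Lemma mono_subproof (x y : G) (n : homset x y) (f : cfun K (s y)) :
  finite_set (supp (mono_coefs n f)).
Proof.
apply: sub_finite_set (finite_set1 (Mor n)) => -[x' [y' m]] /= nz.
apply: contrapT => /eqP; rewrite eq_sym => nm; apply: nz.
by rewrite /mono_coefs dfwith_out.
Qed.

Definition mono (x y : G) (n : homset x y) (f : cfun K (s y)) : skew_alg K s :=
  Skew (mono_subproof n f).

Lemma mono_in (x y : G) (n : homset x y) (f : cfun K (s y)) :
  mono n f _ _ n = f.
Proof. exact: dfwith_in. Qed.

Lemma mono_out (x y x' y' : G) (n : homset x y) (f : cfun K (s y))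
    (m : homset x' y') :
  Mor m <> Mor n -> mono n f _ _ m = 0.
Proof. by move=> /nesym/eqP mn; rewrite /= /mono_coefs dfwith_out. Qed.

Definition delta_coefs (e : G) (f : cfun K (s e)) (e' : G) : cfun K (s e') :=
  @eqtype.dfwith _ (fun e => cfun K (s e)) (fun=> 0) e f e'.

Lemma delta_subproof (e : G) (f : cfun K (s e)) :
  finite_set [set e' | delta_coefs f e' <> 0].
Proof.
apply: sub_finite_set (finite_set1 e) => e' /= nz.
apply: contrapT => /eqP; rewrite eq_sym => ee'; apply: nz.
by rewrite /delta_coefs dfwith_out.
Qed.

Definition delta (e : G) (f : cfun K (s e)) : dirsum K s :=
  Dirsum (delta_subproof f).

Lemma delta_in (e : G) (f : cfun K (s e)) : delta f e = f.
Proof. exact: dfwith_in. Qed.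

Lemma delta_out (e e' : G) (f : cfun K (s e)) : e' <> e -> delta f e' = 0.
Proof. by move=> /nesym/eqP ee'; rewrite /= /delta_coefs dfwith_out. Qed.

Lemma embed_id d (x : G) : embed d _ _ (idmor x) = d x.
Proof. by rewrite /= /embed_coefs asboolT//; exists x. Qed.

Lemma embed_out d (x y : G) (n : homset x y) :
  ~ is_identity n -> embed d _ _ n = 0.
Proof. by move=> nid; rewrite /= /embed_coefs asboolF. Qed.

Lemma is_identity_endo (e : G) (n : homset e e) :
  is_identity n -> n = idmor e.
Proof.
by case=> e' ne; have ee := Mor_dom ne; subst e'; exact: Mor_inj ne.
Qed.

Lemma diagP a :
  diag K s a <->
  forall (x y : G) (n : homset x y), ~ is_identity n -> a _ _ n = 0.
Proof.
split=> [[d _ <-] x y n|a0]; first exact: embed_out.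
have fin : finite_set [set e : G | a _ _ (idmor e) <> 0].
  apply: sub_finite_set
    (finite_image (fun m : mor G => projT1 m) (coef_fin a)) => e /= ae.
  by exists (Mor (idmor e)).
exists (Dirsum (dcoef := fun e => a _ _ (idmor e)) fin) => //.
apply: Defs.skewP => x y n.
have [nid|nid] := pselect (is_identity n); last by rewrite embed_out// a0.
case: (nid) => e ne; have xe := Mor_dom ne; have ye := Mor_cod ne; subst x y.
by rewrite (Mor_inj ne) embed_id.
Qed.

Lemma skewM_embedl d b (x y : G) (n : homset x y) :
  skewM (embed d) b _ _ n = d y * b _ _ n.
Proof.
pose t : {e : G & (homset e y * homset x e)%type} :=
  existT (fun e => (homset e y * homset x e)%type) y (idmor y, n).
rewrite /= /skewM_coefs (@fsbig_single _ _ _ t).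
- by rewrite [X in X * _]embed_id sigma_idmor.
- by rewrite /factorizations /= mcomp1m.
move=> [e [f g]] /= fg nt.
have [[e' fe]|fid] := pselect (is_identity f); last first.
  by rewrite [X in X * _]embed_out ?mul0r.
have ee := Mor_dom fe; have ye := Mor_cod fe; subst e e'.
by case: nt; rewrite /t -fg (Mor_inj fe) mcomp1m.
Qed.

Lemma skewM_embedr d b (x y : G) (n : homset x y) :
  skewM b (embed d) _ _ n = b _ _ n * sigma n (d x).
Proof.
pose t : {e : G & (homset e y * homset x e)%type} :=
  existT (fun e => (homset e y * homset x e)%type) x (n, idmor x).
rewrite /= /skewM_coefs (@fsbig_single _ _ _ t).
- by congr (_ * sigma _ _); exact: embed_id.
- by rewrite /factorizations /= mcompm1.
move=> [e [f g]] /= fg nt.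
have [[e' ge]|gid] := pselect (is_identity g); last first.
  by rewrite [embed_coefs _ _]embed_out ?sigma0 ?mulr0.
have xe := Mor_dom ge; have ee := Mor_cod ge; subst x e'.
by case: nt; rewrite /t -fg (Mor_inj ge) mcompm1.
Qed.

Lemma subalgebra_diag : subalgebra (diag K s).
Proof.
split=> [|k a b /diagP a0 /diagP b0|a b [d _ <-] /diagP b0];
  apply/diagP => x y n nid //.
- by rewrite /= a0// b0// scaler0 addr0.
- by rewrite skewM_embedl b0// mulr0.
Qed.

Lemma commutant_diag_sub : diag K s `<=` commutant (diag K s).
Proof.
move=> a ada b bda; case: (ada) => d _ <-.
apply: Defs.skewP => x y n; rewrite skewM_embedl skewM_embedr.
have [[e ne]|nid] := pselect (is_identity n).
  have xe := Mor_dom ne; have ye := Mor_cod ne; subst x y.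
  by rewrite (Mor_inj ne) sigma_idmor mulrC.
by move/diagP: bda => /(_ _ _ _ nid) ->; rewrite mulr0 mul0r.
Qed.

Hypothesis sT : forall e : G, tychonoff_space K (s e).

Lemma cfun_separates (e : G) (p q : s e) :
  p <> q -> exists f : cfun K (s e), f p <> f q.
Proof.
move=> pq; have [+ cr] := sT e => /hausdorff_accessible/(_ _ _ (introN eqP pq)).
move=> [U [oU [/set_mem Up /set_mem Uq]]].
have [f [fp f0]] := cr U p oU Up.
by exists f; rewrite fp f0//; apply/eqP; rewrite oner_eq0.
Qed.

Lemma commutant_diag :
  topologically_free s -> commutant (diag K s) `<=` diag K s.
Proof.
move=> tf a comma; apply/diagP => x y n nid; apply: contrapT => an0.
have [z az0] := cfun_neq0 an0.
have comm d w : a _ _ n w * d x (smap s n w) = d y w * a _ _ n w.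
  have := comma (embed d) (ex_intro2 _ _ d I erefl).
  by move/(congr1 (fun b => b _ _ n w)); rewrite skewM_embedl skewM_embedr.
have [yx|yx] := pselect (y = x); last first.
  have := comm (delta (1 : cfun K (s x))) z.
  by rewrite delta_in delta_out// mul0r mulr1.
subst y.
have [|p [/= ap0 aper]] := tf x _ _ (@open_cfun_neq0 _ (a x x n)).
  by exists z.
apply: aper; exists n; split.
  by move=> ne; apply: nid; exists x; rewrite ne.
apply: contrapT => /cfun_separates[f]; apply.
have := comm (delta f) p; rewrite delta_in mulrC => /mulIf; apply.
exact/eqP.
Qed.

Lemma moved_nbhs (e : G) (k : homset e e) (p : s e) :
  smap s k p <> p ->
  exists O, nbhs p O /\ forall z, O z -> ~ O (smap s k z).
Proof.
move=> /nesym/eqP kp; have [+ _] := sT e; rewrite open_hausdorff => /(_ _ _ kp).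
move=> [[V W] /= [/set_mem Vp /set_mem Wp] [oV oW /eqP VW]].
exists (V `&` smap s k @^-1` W); split.
  apply: filterI; first exact: open_nbhs_nbhs.
  by apply: smap_continuous; exact: open_nbhs_nbhs.
move=> z [_ Wz] [Vz _]; suff : set0 (smap s k z) by [].
by rewrite -VW.
Qed.

Hypothesis sB : forall e : G, baire_space (s e).
Hypothesis cG : forall e : G, countable [set: homset e e].

Lemma not_topologically_free : ~ topologically_free s ->
  exists (e : G) (n : homset e e) (f : cfun K (s e)),
    [/\ n <> idmor e, f <> 0 & forall z, f z <> 0 -> smap s n z = z].
Proof.
move=> /existsNP[e /denseNE[O [[z [oO Oz]] Oper]]].
suff [n [nid [V [oV [v Vv] Vfix]]]] : exists n : homset e e, n <> idmor e /\
    exists V, [/\ open V, V !=set0 & forall z, V z -> smap s n z = z].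
  have [_ /(_ V v oV Vv)[f [f1 f0]]] := sT e.
  exists e, n, f; split=> // [f00|w fw].
    by move/eqP: f1; rewrite f00 /= eq_sym oner_eq0.
  by apply: Vfix; apply: contrapT => /f0.
apply: contrapT => nofix.
have /countable_injP[g ginj] := cG e.
pose F i := [set w | forall n : homset e e,
  n <> idmor e -> g n = i -> smap s n w <> w].
have FT i : (exists n : homset e e, n <> idmor e /\ g n = i /\
    F i = ~` [set w | smap s n w = w]) \/ F i = setT.
  have [[n [nid gn]]|non] := pselect (exists n, n <> idmor e /\ g n = i).
    left; exists n; split=> //; split=> //; apply/seteqP; split=> w /=.
      exact.
    move=> nw m mid gm.
    by have -> : m = n by apply: ginj; rewrite ?inE// gm.
  right; apply/seteqP; split=> // w _ n nid gn; case: non; by exists n.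
have Fod i : open (F i) /\ dense (F i).
  case: (FT i) => [[n [nid [_ ->]]]|->]; last first.
    by split=> [|U [u Uu] _]; [exact: openT|exists u].
  split.
    rewrite openE => w /= nw.
    have [U [Uw Un]] := moved_nbhs nw.
    by apply: filterS Uw => w' Uw' /= w'w'; apply: (Un w' Uw'); rewrite w'w'.
  move=> U [u Uu] oU; apply: contrapT => /forallNP UF; apply: nofix.
  exists n; split=> //; exists U; split=> //; first by exists u.
  by move=> w Uw; apply: contrapT => nw; apply: (UF w).
have [w [Ow Fw]] := sB Fod (ex_intro _ z Oz) oO.
suff : set0 w by [].
rewrite -Oper; split=> // -[n [nid nw]].
exact: (Fw (g n) I n nid erefl).
Qed.

Lemma commutant_nondiag (e : G) (n : homset e e) (f : cfun K (s e)) :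
  n <> idmor e -> f <> 0 -> (forall z, f z <> 0 -> smap s n z = z) ->
  commutant (diag K s) (mono n f) /\ ~ diag K s (mono n f).
Proof.
move=> nid f0 fix_n; split; last first.
  move/diagP/(_ _ _ n); rewrite mono_in => nf; apply/f0/nf.
  by move/is_identity_endo.
move=> _ [d _ <-]; apply: Defs.skewP => x y m.
rewrite skewM_embedl skewM_embedr.
have [mn|mn] := pselect (Mor m = Mor n); last by rewrite mono_out// mulr0 mul0r.
have xe := Mor_dom mn; have ye := Mor_cod mn; subst x y.
rewrite (Mor_inj mn) mono_in [RHS]mulrC; apply: cfun_eq => z.
change (f z * d e (smap s n z) = f z * d e z).
by have [->|/fix_n ->//] := pselect (f z = 0); rewrite !mul0r.
Qed.

Lemma maximal_abelianP :
  topologically_free s <-> maximal_abelian_subalgebra (diag K s).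
Proof.
split=> [tf|[_ comm]].
  split; first exact: subalgebra_diag.
  by apply/seteqP; split; [exact: commutant_diag|exact: commutant_diag_sub].
apply: contrapT => /not_topologically_free[e [n [f [nid f0 fix_n]]]].
by have [] := commutant_nondiag nid f0 fix_n; rewrite comm.
Qed.

Hypothesis gG : groupoid G.

Definition minv (x y : G) (n : homset x y) : homset y x :=
  projT1 (cid (gG n)).

Lemma mulVm (x y : G) (n : homset x y) : mcomp (minv n) n = idmor x.
Proof. by rewrite /minv; case: cid => m []. Qed.

Lemma mulmV (x y : G) (n : homset x y) : mcomp n (minv n) = idmor y.
Proof. by rewrite /minv; case: cid => m []. Qed.

Lemma mulKm (x y z : G) (n : homset y z) (m : homset x y) :
  mcomp (minv n) (mcomp n m) = m.
Proof. by rewrite mcompA mulVm mcomp1m. Qed.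

Lemma mulVKm (x y z : G) (n : homset y z) (m : homset x z) :
  mcomp n (mcomp (minv n) m) = m.
Proof. by rewrite mcompA mulmV mcomp1m. Qed.

Lemma mulmK (x y z : G) (n : homset x y) (m : homset y z) :
  mcomp (mcomp m n) (minv n) = m.
Proof. by rewrite -mcompA mulmV mcompm1. Qed.

Lemma mulmVK (x y z : G) (n : homset x y) (m : homset x z) :
  mcomp (mcomp m (minv n)) n = m.
Proof. by rewrite -mcompA mulVm mcompm1. Qed.

Lemma skewM_monor a (x y z : G) (n : homset x y) (f : cfun K (s y))
    (k : homset x z) :
  skewM a (mono n f) _ _ k =
  a _ _ (mcomp k (minv n)) * sigma (mcomp k (minv n)) f.
Proof.
pose t : {e : G & (homset e z * homset x e)%type} :=
  existT (fun e => (homset e z * homset x e)%type) y (mcomp k (minv n), n).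
rewrite /= /skewM_coefs (@fsbig_single _ _ _ t).
- by congr (_ * sigma _ _); exact: mono_in.
- by rewrite /factorizations /= mulmVK.
move=> [e [g h]] /= gh nt.
have [hn|hn] := pselect (Mor h = Mor n); last first.
  by rewrite [mono_coefs _ _ _]mono_out ?sigma0 ?mulr0.
have ey := Mor_cod hn; subst e; case: nt.
by rewrite /t -(Mor_inj hn) -gh mulmK.
Qed.

Lemma skewM_monor_out a (x x' y z : G) (n : homset x y) (f : cfun K (s y))
    (k : homset x' z) :
  x' <> x -> skewM a (mono n f) _ _ k = 0.
Proof.
move=> xx; rewrite /= /skewM_coefs fsbig1// => -[e [g h]] /= gh.
by rewrite [mono_coefs _ _ _]mono_out ?sigma0 ?mulr0// => /Mor_dom.
Qed.

(* With [b = (h u_y) a (h' u_(n^-1))] and [h' = sigma (n^-1) h], the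
   coefficient of [b] at [k : y -> y] is [h * a_(k n) * (h o s(k))], which
   vanishes for [k <> id] as soon as [s(k)] moves the support of [h] off
   itself. *)
Lemma ideal_meets_diag (I : set (skew_alg K s)) : topologically_free s ->
  two_sided_ideal I -> I <> [set 0] -> I `&` diag K s <> [set 0].
Proof.
move=> tf [I0 _ Il Ir] In0 ID0.
have [a [Ia a0]] : exists a, I a /\ a <> 0.
  apply: contrapT => /forallNP Ia; apply: In0; apply/seteqP; split=> a /=.
    by move=> aI; apply: contrapT => a0; apply: (Ia a).
  by move=> ->.
have [x [y [n an0]]] : exists (x y : G) (n : homset x y), a _ _ n <> 0.
  apply: contrapT => na; apply: a0; apply: Defs.skewP => x y n.
  by apply: contrapT => an; apply: na; exists x, y, n.
have [z0 az0] := cfun_neq0 an0.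
have [|p [/= ap0 aper]] := tf y _ _ (@open_cfun_neq0 _ (a _ _ n)).
  by exists z0.
have moved k : exists O, nbhs p O /\
    (k <> idmor y -> forall z, O z -> ~ O (smap s k z)).
  have [->|kid] := pselect (k = idmor y).
    by exists setT; split=> //; exact: filterT.
  have [|O [Op Ok]] := @moved_nbhs y k p; last by exists O.
  by move=> kp; apply: aper; exists k.
have [O OP] := choice moved.
have finF : finite_set [set k : homset y y | a _ _ (mcomp k n) <> 0].
  apply: (@finite_preimage _ _ (supp a) (fun k => Mor (mcomp k n))).
    move=> k k' _ _ /Mor_inj/(congr1 (fun m => mcomp m (minv n))).
    by rewrite !mulmK.
  exact: coef_fin.
pose U := (\bigcap_(k in [set` fset_set
  [set k : homset y y | a _ _ (mcomp k n) <> 0]]) O k)%classic.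
have Up : nbhs p U by apply: filter_bigI => k _; exact: (OP k).1.
have [_ cr] := sT y.
have [h [hp h0]] := cr _ p (@open_interior _ U) Up.
pose b := skewM (skewM (embed (delta h)) a) (mono (minv n) (sigma (minv n) h)).
have Ib : I b by apply: Ir; apply: Il.
have bE (k : homset y y) z :
    b _ _ k z = h z * a _ _ (mcomp k n) z * h (smap s k z).
  rewrite /b; set m := minv n; rewrite skewM_monor.
  have -> : mcomp k (minv m) = mcomp k n.
    by congr mcomp; rewrite -[LHS]mcomp1m -(mulmV n) -/m -mcompA mulmV mcompm1.
  rewrite skewM_embedl delta_in.
  have -> : sigma (mcomp k n) (sigma m h) = sigma k h :> cfun K (s y).
    apply: cfun_eq => w /=.
    rewrite -[X in h X]/((smap s m \o smap s (mcomp k n)) w).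
    by rewrite -smap_comp /m mulmK.
  by [].
have bD : diag K s b.
  apply/diagP => x' y' k kid.
  have [xy|xy] := pselect (x' = y); last by rewrite skewM_monor_out.
  subst x'; have [yy|yy] := pselect (y' = y); last first.
    by rewrite skewM_monor skewM_embedl delta_out// !mul0r.
  subst y'; apply: cfun_eq => z; rewrite bE -[RHS]/0.
  have kid' : k <> idmor y by move=> ke; apply: kid; exists y; rewrite ke.
  have [akn|akn] := pselect (a _ _ (mcomp k n) = 0).
    by rewrite akn [X in h z * X]/= mulr0 mul0r.
  have [hz|hz] := pselect (h z = 0); first by rewrite hz !mul0r.
  have [hk|hk] := pselect (h (smap s k z) = 0); first by rewrite hk mulr0.
  have hU w : h w <> 0 -> O k w.
    move=> hw; have /interior_subset : U^° w by apply: contrapT => /h0.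
    by apply; rewrite /= in_fset_set// inE.
  by have := (OP k).2 kid' z (hU _ hz) (hU _ hk).
have : [set (0 : skew_alg K s)] b by rewrite -ID0.
move=> /= b0; have := bE (idmor y) p.
rewrite b0 hp mcomp1m mul1r smap_id /= hp mulr1 => /esym.
exact: ap0.
Qed.

Definition supp_to a (y : G) : set {x : G & homset x y} :=
  [set p | a _ _ (projT2 p) <> 0].
Arguments supp_to a y : clear implicits.

Lemma finite_supp_to a (y : G) : finite_set (supp_to a y).
Proof.
apply: (@finite_preimage _ _ (supp a)
  (fun p : {x : G & homset x y} => Mor (projT2 p))); last exact: coef_fin.
move=> [x m] [x' m'] _ _ /= mm; have xx := Mor_dom mm; subst x'.
by rewrite (Mor_inj mm).
Qed.

Lemma skewM_groupoid a b (x y : G) (k : homset x y)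
    (D : set {e : G & homset e y}) : supp_to a y `<=` D ->
  skewM a b _ _ k = \sum_(q \in D)
    a _ _ (projT2 q) * sigma (projT2 q) (b _ _ (mcomp (minv (projT2 q)) k)).
Proof.
move=> aD; pose h (q : {e : G & homset e y}) :
    {e : G & (homset e y * homset x e)%type} :=
  existT (fun e => (homset e y * homset x e)%type) (projT1 q)
    (projT2 q, mcomp (minv (projT2 q)) k).
rewrite /= /skewM_coefs (reindex_fsbig h setT).
  apply/esym/fsbig_widen => // q [_ /=] qD.
  suff -> : a _ _ (projT2 q) = 0 by rewrite mul0r.
  by apply: contrapT => /aD.
split.
- by move=> q _; rewrite /factorizations /= mulVKm.
- move=> [e m] [e' m'] _ _.
  by move/(congr1 (fun t =>
    existT (fun e => homset e y : Type) (projT1 t) (projT2 t).1)).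
- move=> [e [m m']] /= mm; exists (existT _ e m) => //.
  by rewrite /h /= -mm mulKm.
Qed.

Lemma fsbig_cfunE (X : topologicalType) (T : choiceType) (D : set T)
    (F : T -> cfun K X) (z : X) : finite_set D ->
  (\sum_(i \in D) F i) z = \sum_(i \in D) F i z.
Proof.
move=> finD; rewrite !fsbig_finite//.
exact: (big_morph (fun f : cfun K X => f z)).
Qed.

(* The covariant representation of the algebra on the functions on the
   disjoint union of the fibers. *)
Definition rep a (phi : forall x : G, s x -> K) (y : G) (z : s y) : K :=
  \sum_(p \in [set: {x : G & homset x y}])
    a _ _ (projT2 p) z * phi (projT1 p) (smap s (projT2 p) z).

Lemma repE a (phi : forall x : G, s x -> K) (y : G) (z : s y)
    (D : set {x : G & homset x y}) : supp_to a y `<=` D ->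
  rep a phi z =
  \sum_(p \in D) a _ _ (projT2 p) z * phi (projT1 p) (smap s (projT2 p) z).
Proof.
move=> aD; apply/esym/fsbig_widen => // p [_ /=] pD.
have -> : a _ _ (projT2 p) = 0 by apply: contrapT => /aD.
by rewrite mul0r.
Qed.

Lemma repM a b (phi : forall x : G, s x -> K) (y : G) (z : s y) :
  rep (skewM a b) phi z = rep a (rep b phi) z.
Proof.
pose D := supp_to a y; have finD : finite_set D := finite_supp_to a y.
pose E := \bigcup_(q in D) [set existT (fun x => homset x y : Type) (projT1 p)
  (mcomp (projT2 q) (projT2 p)) | p in supp_to b (projT1 q)].
have finE : finite_set E.
  apply: bigcup_finite => // q _; apply: finite_image; exact: finite_supp_to.
have bE (q : {e : G & homset e y}) (k : {x : G & homset x y}) : D q -> ~ E k ->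
    b _ _ (mcomp (minv (projT2 q)) (projT2 k)) = 0.
  move=> Dq Ek; apply: contrapT => bk; apply: Ek; exists q => //.
  exists (existT _ (projT1 k) (mcomp (minv (projT2 q)) (projT2 k))) => //=.
  by rewrite mulVKm; case: k {bk}.
rewrite (@repE _ _ _ _ E); last first.
  move=> k abk; apply: contrapT => Ek; apply: abk.
  rewrite (@skewM_groupoid _ _ _ _ _ D)//; apply: fsbig1 => q Dq.
  by rewrite bE// sigma0 mulr0.
rewrite (@repE a _ _ _ D)//.
under eq_fsbigr do
  rewrite (@skewM_groupoid _ _ _ _ _ D)// fsbig_cfunE// mulr_fsuml.
rewrite exchange_fsbig//; apply: eq_fsbigr => q /set_mem Dq.
under eq_fsbigr do rewrite -mulrA.
rewrite -mulr_fsumr; congr (_ * _).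
rewrite (@repE _ _ _ _ (supp_to b (projT1 q)))//.
pose h (p : {x : G & homset x (projT1 q)}) : {x : G & homset x y} :=
  existT _ (projT1 p) (mcomp (projT2 q) (projT2 p)).
rewrite -(@fsbig_widen _ _ _ _ (h @` supp_to b (projT1 q)) E); first last.
- move=> k [_ /= kh]; set c := b _ _ _.
  suff -> : c = 0 by rewrite [X in X * _]/= mul0r.
  apply: contrapT => bk; apply: kh.
  exists (existT _ (projT1 k) (mcomp (minv (projT2 q)) (projT2 k))) => //.
  by rewrite /h /= mulVKm; case: k {c bk}.
- by move=> _ [p bp <-]; exists q => //; exists p.
rewrite fsbig_image; last first.
  move=> [x m] [x' m'] _ _ mm; have xx := congr1 (@projT1 _ _) mm.
  rewrite /= in xx; subst x'; move/eqP: mm; rewrite eq_Tagged /= => /eqP.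
  by move/(congr1 (mcomp (minv (projT2 q)))); rewrite !mulKm => ->.
apply: eq_fsbigr => p _; rewrite /= mulKm.
by rewrite smap_comp.
Qed.

Lemma repB a b (phi : forall x : G, s x -> K) (y : G) (z : s y) :
  rep (a - b) phi z = rep a phi z - rep b phi z.
Proof.
pose D := supp_to a y `|` supp_to b y.
have finD : finite_set D by rewrite finite_setU; split; exact: finite_supp_to.
rewrite (@repE (a - b) _ _ _ D); last first.
  move=> p abp; apply: contrapT => /not_orP[/contrapT ap /contrapT bp].
  by apply: abp => /=; rewrite ap bp subr0.
rewrite (@repE a _ _ _ D); last by move=> p; left.
rewrite (@repE b _ _ _ D); last by move=> p; right.
rewrite !fsbig_finite// -sumrB; apply: eq_bigr => p _.
by rewrite -mulrBl.
Qed.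

Lemma rep_single a (phi : forall x : G, s x -> K) (x y : G) (n : homset x y)
    (z : s y) :
  (forall (x' : G) (m : homset x' y), Mor m <> Mor n -> a _ _ m = 0) ->
  rep a phi z = a _ _ n z * phi x (smap s n z).
Proof.
move=> a0; rewrite /rep (@fsbig_single _ _ _ (existT _ x n))//.
move=> [x' m] _ /= mn.
rewrite a0 ?mul0r// => mn'; apply: mn; have xx := Mor_dom mn'; subst x'.
by rewrite (Mor_inj mn').
Qed.

Lemma rep_embed d (phi : forall x : G, s x -> K) (y : G) (z : s y) :
  rep (embed d) phi z = d y z * phi y z.
Proof.
rewrite (@rep_single _ _ _ _ (idmor y)) ?embed_id ?smap_id// => x m my.
by apply: embed_out => -[e me]; apply: my; rewrite me -(Mor_cod me).
Qed.

Lemma rep_mono (x y : G) (n : homset x y) (f : cfun K (s y))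
    (phi : forall x : G, s x -> K) (z : s y) :
  rep (mono n f) phi z = f z * phi x (smap s n z).
Proof.
by rewrite (@rep_single _ _ _ _ n) ?mono_in// => x' m; exact: mono_out.
Qed.

Definition rep_kernel : set (skew_alg K s) :=
  [set a | forall (phi : forall x : G, s x -> K) (y : G) (z : s y),
     rep a phi z = 0].

Lemma two_sided_ideal_rep_kernel : two_sided_ideal rep_kernel.
Proof.
split=> [phi y z|a b a0 b0 phi y z|a b b0 phi y z|a b a0 phi y z].
- by rewrite /rep fsbig1// => p _; rewrite [X in X * _]/= mul0r.
- by rewrite repB a0 b0 subr0.
- by rewrite repM /rep fsbig1// => p _; rewrite [X in _ * X]b0 mulr0.
- by rewrite repM a0.
Qed.

Lemma rep_kernel_diag : rep_kernel `&` diag K s = [set 0].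
Proof.
apply/seteqP; split=> [a [ker [d _ da]]|_ ->]; last first.
  by split; [case: two_sided_ideal_rep_kernel|apply/diagP].
subst a; suff d0 y : d y = 0.
  apply: Defs.skewP => x y n /=; rewrite /embed_coefs d0.
  by case: ifP.
apply: cfun_eq => z; have := ker (fun _ _ => 1) y z.
by rewrite rep_embed mulr1.
Qed.

Lemma ideal_intersectionP :
  topologically_free s <->
  (forall I : set (skew_alg K s),
     two_sided_ideal I -> I <> [set 0] -> I `&` diag K s <> [set 0]).
Proof.
split=> [tf I|meet]; first exact: ideal_meets_diag.
apply: contrapT => /not_topologically_free[e [n [f [nid f0 fix_n]]]].
apply: (meet _ two_sided_ideal_rep_kernel) rep_kernel_diag => ker0.
have : rep_kernel (embed (delta f) - mono n f).
  move=> phi y z; rewrite repB rep_embed.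
  have [ye|ye] := pselect (y = e); last first.
    rewrite delta_out// mul0r /rep fsbig1 ?subr0// => -[x m] _.
    by rewrite mono_out ?mul0r// => /Mor_cod.
  subst y; rewrite delta_in rep_mono.
  by have [->|/fix_n->] := pselect (f z = 0); rewrite ?mul0r subrr.
rewrite ker0 => /(congr1 (fun b : skew_alg K s => b _ _ n)) /=.
rewrite [embed_coefs _ _]embed_out; last by move/is_identity_endo.
by rewrite [mono_coefs _ _ _]mono_in sub0r => /eqP; rewrite oppr_eq0 => /eqP.
Qed.

End algebra.

Unset Implicit Arguments.

Theorem theorem3 (R : realType) (G : category) (s : dynsys G) :
  groupoid G ->
  (forall e : G, countable [set: homset e e]) ->
  (forall e : G, tychonoff_space R[i] (s e)) ->
  (forall e : G, baire_space (s e)) ->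
  let A := diag R[i] s in
  (topologically_free s <->
     (forall I : set (skew_alg R[i] s),
        two_sided_ideal I -> I <> [set 0] -> I `&` A <> [set 0])) /\
  (topologically_free s <-> maximal_abelian_subalgebra A).
Proof.
move=> gG cG sT sB; split.
  exact: ideal_intersectionP.
exact: maximal_abelianP.
Qed.
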